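(* Let $F_{\underline{132}}(x,t,z)=\sum_{n\ge0}\sum_{\pi\in\mathbf I_n(3412)}x^n t^{\mathrm{occ}_{132}(\pi)}z^{\mathrm{fix}(\pi)}$. Then $$F_{\underline{132}}(x,t,z)=\frac{2}{1-xz+x^2t-x^2+\sqrt{(1-xz-x^2(t-1))^2-4x(x+x^2z(t-1))}}.$$
   Context: $\mathbf I_n(3412)$ is the set of involutions of $\{1,\dots,n\}$ with no subsequence order-isomorphic to $3412$. $\mathrm{occ}_{132}(\pi)$ is the number of indices $i$ such that $\pi_i\pi_{i+1}\pi_{i+2}$ is order-isomorphic to $132$, and $\mathrm{fix}(\pi)$ is the number of fixed points. *)

(* Defs.v *)
From HB Require Import structures.
From mathcomp Require Import all_boot all_order all_algebra all_fingroup.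
From mathcomp Require Import boolp.

Set Implicit Arguments.
Unset Strict Implicit.
Unset Printing Implicit Defensive.

Import GRing.Theory.
Local Open Scope ring_scope.

(* Formal power series, as coefficient sequences with the Cauchy product. *)

Record fps (R : Type) := Fps { fcoef :> nat -> R }.

Lemma fpsP (R : Type) (f g : fps R) : (forall n, f n = g n) <-> f = g.
Proof.
split=> [|->//]; case: f g => [f] [g] /= fg; congr Fps; exact: funext.
Qed.

HB.instance Definition _ (R : Type) := gen_eqMixin (fps R).
HB.instance Definition _ (R : Type) := gen_choiceMixin (fps R).

(* [course step] is the sequence u such that
   u n = step [:: u 0; ...; u (n - 1)]. *)
Section CourseOfValues.
Variables (R : nmodType) (step : seq R -> R).

Fixpoint course_seq n : seq R :=
  if n is m.+1 then rcons (course_seq m) (step (course_seq m)) else [::].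

Definition course n : R := step (course_seq n).

Lemma size_course_seq n : size (course_seq n) = n.
Proof. by elim: n => //= n IHn; rewrite size_rcons IHn. Qed.

Lemma nth_course_seq n i : (i < n)%N -> (course_seq n)`_i = course i.
Proof.
elim: n => //= n IHn; rewrite ltnS leq_eqVlt nth_rcons size_course_seq.
by case: ltngtP => //= [/IHn //|->].
Qed.

End CourseOfValues.

Section FpsRing.
Variable R : comNzRingType.
Implicit Types f g h : fps R.

Definition fpsC (c : R) : fps R := Fps (fun n => if n == 0%N then c else 0).
Definition fpsX : fps R := Fps (fun n => (n == 1%N)%:R).

Definition fps_add f g : fps R := Fps (fun n => f n + g n).
Definition fps_opp f : fps R := Fps (fun n => - f n).
Definition fps_mul f g : fps R :=
  Fps (fun n => \sum_(i < n.+1) f i * g (n - i)%N).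

Fact fps_addA : associative fps_add.
Proof. by move=> f g h; apply/fpsP => n /=; rewrite addrA. Qed.
Fact fps_addC : commutative fps_add.
Proof. by move=> f g; apply/fpsP => n /=; rewrite addrC. Qed.
Fact fps_add0 : left_id (fpsC 0) fps_add.
Proof. by move=> f; apply/fpsP => n /=; rewrite if_same add0r. Qed.
Fact fps_addN : left_inverse (fpsC 0) fps_opp fps_add.
Proof. by move=> f; apply/fpsP => n /=; rewrite if_same addNr. Qed.

HB.instance Definition _ := GRing.isZmodule.Build (fps R)
  fps_addA fps_addC fps_add0 fps_addN.

Let trunc N f : {poly R} := \poly_(i < N) f i.

Let truncE N f n : (n < N)%N -> (trunc N f)`_n = f n.
Proof. by move=> ltnN; rewrite coef_poly ltnN. Qed.

Let fps_mulE N f g n :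
  (n < N)%N -> fps_mul f g n = (trunc N f * trunc N g)`_n.
Proof.
move=> ltnN; rewrite coefM /=; apply: eq_bigr => i _.
rewrite !truncE //; first exact: leq_ltn_trans (leq_subr _ _) ltnN.
by apply: leq_ltn_trans ltnN; rewrite -ltnS.
Qed.

Fact fps_mulC : commutative fps_mul.
Proof. by move=> f g; apply/fpsP => n; rewrite !(@fps_mulE n.+1) // mulrC. Qed.

Fact fps_mulA : associative fps_mul.
Proof.
move=> f g h; apply/fpsP => n.
transitivity ((trunc n.+1 f * (trunc n.+1 g * trunc n.+1 h))`_n).
  rewrite coefM /=; apply: eq_bigr => i _.
  by rewrite truncE // -(@fps_mulE n.+1) // ltnS leq_subr.
rewrite mulrA coefM; apply: eq_bigr => i _.
by rewrite -(@fps_mulE n.+1) // truncE // ltnS leq_subr.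
Qed.

Fact fps_mul1 : left_id (fpsC 1) fps_mul.
Proof.
move=> f; apply/fpsP => n /=.
rewrite big_ord_recl /= mul1r subn0 big1 ?addr0 // => i _.
by rewrite mul0r.
Qed.

Fact fps_mulD : left_distributive fps_mul fps_add.
Proof.
move=> f g h; apply/fpsP => n /=; rewrite -big_split /=.
by apply: eq_bigr => i _; rewrite mulrDl.
Qed.

Fact fps_oner_neq0 : fpsC 1 != 0.
Proof. by apply/eqP => /fpsP /(_ 0%N) /eqP /=; rewrite oner_eq0. Qed.

HB.instance Definition _ := GRing.Zmodule_isComNzRing.Build (fps R)
  fps_mulA fps_mulC fps_mul1 fps_mulD fps_oner_neq0.

Lemma fcoefM f g n : (f * g) n = \sum_(i < n.+1) f i * g (n - i)%N.
Proof. by []. Qed.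

Lemma fcoef1 n : (1 : fps R) n = (n == 0%N)%:R.
Proof. by rewrite /=; case: eqP. Qed.

End FpsRing.

Section FpsUnitRing.
Variable R : comUnitRingType.
Implicit Types f g : fps R.

Definition fps_unit : {pred fps R} := fun f => f 0%N \is a GRing.unit.

(* Solves \sum_(i <= n) g_i f_(n - i) = [n = 0] for g_n. *)
Definition fps_inv_step f (s : seq R) : R :=
  (f 0%N)^-1 *
    ((size s == 0%N)%:R - \sum_(i < size s) s`_i * f (size s - i)%N).

Definition fps_inv f : fps R :=
  if f \in fps_unit then Fps (course (fps_inv_step f)) else f.

Fact fps_mulVf : {in fps_unit, left_inverse 1 fps_inv *%R}.
Proof.
move=> f Uf; apply/fpsP => n; rewrite fcoef1 fcoefM big_ord_recr /= subnn.
rewrite /fps_inv Uf /= {2}/course /fps_inv_step size_course_seq.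
rewrite mulrC mulrA divrr // mul1r addrC -[RHS]addr0 -addrA; congr (_ + _).
apply/eqP; rewrite addrC subr_eq0; apply/eqP/eq_bigr => i _.
by rewrite nth_course_seq.
Qed.

Fact fps_unitPl f g : g * f = 1 -> f \in fps_unit.
Proof.
move=> /fpsP /(_ 0%N); rewrite fcoefM big_ord1 fcoef1 => gf1.
by apply/unitrPr; exists (g 0%N); rewrite mulrC.
Qed.

Fact fps_inv_out : {in [predC fps_unit], fps_inv =1 id}.
Proof. by move=> f; rewrite inE /fps_inv => /negbTE ->. Qed.

HB.instance Definition _ := GRing.ComNzRing_hasMulInverse.Build (fps R)
  fps_mulVf fps_unitPl fps_inv_out.

(* The square root with constant term 1, meaningful when d 0 = 1 and 2 is
   invertible (see fps_sqrt_sqr and fps_sqrt_unique): solves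
   \sum_(i <= n) s_i s_(n - i) = d_n for s_n. *)
Definition fps_sqrt_step (d : fps R) (s : seq R) : R :=
  if size s is n.+1 then
    (d n.+1 - \sum_(i < n) s`_i.+1 * s`_(n - i)) / 2%:R
  else 1.

Definition fps_sqrt (d : fps R) : fps R := Fps (course (fps_sqrt_step d)).

Lemma fps_sqrt0 (d : fps R) : fps_sqrt d 0%N = 1.
Proof. by []. Qed.

Lemma fps_sqrt_sqr (d : fps R) :
  2%:R \is a @GRing.unit R -> d 0%N = 1 -> fps_sqrt d ^+ 2 = d.
Proof.
move=> U2 d0; apply/fpsP => -[|n]; rewrite expr2 fcoefM.
  by rewrite big_ord1 !fps_sqrt0 mulr1.
set r := fps_sqrt d.
have rS : r n.+1 * 2%:R = d n.+1 - \sum_(i < n) r i.+1 * r (n - i)%N.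
  rewrite /r /= {1}/course /fps_sqrt_step size_course_seq divrK //.
  by congr (_ - _); apply: eq_bigr => i _; rewrite !nth_course_seq ?ltnS ?leq_subr.
have -> : \sum_(i < n.+2) r i * r (n.+1 - i)%N =
          r n.+1 * 2%:R + \sum_(i < n) r i.+1 * r (n - i)%N.
  rewrite big_ord_recr big_ord_recl [nat_of_ord ord_max]/= subnn !fps_sqrt0 ?mul1r.
  by rewrite mulr1 mulr_natr mulr2n [RHS]addrAC.
by rewrite rS subrK.
Qed.

Lemma fps_sqrt_unique (d s : fps R) :
  2%:R \is a @GRing.unit R -> s ^+ 2 = d -> s 0%N = 1 -> s = fps_sqrt d.
Proof.
move=> U2 sd s0; set r := fps_sqrt d.
have d0 : d 0%N = 1 by rewrite -sd expr2 fcoefM big_ord1 s0 mulr1.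
have Usr : s + r \is a GRing.unit.
  by rewrite -[_ \is a _]/(s 0%N + 1 \is a GRing.unit) s0.
apply/eqP; rewrite -subr_eq0 -(mulrI_eq0 _ (mulrI Usr)) mulrC -subr_sqr.
by rewrite fps_sqrt_sqr // sd subrr.
Qed.

End FpsUnitRing.

Local Close Scope ring_scope.

Definition order_iso (u v : seq nat) : bool :=
  (size u == size v) &&
  [forall i : 'I_(size u), forall j : 'I_(size u),
     (nth 0 u i < nth 0 u j) == (nth 0 v i < nth 0 v j)].

Section Permutations.
Variable n : nat.
Implicit Type p : 'S_n.

(* One-line notation, with values in {1, ..., n}. *)
Definition one_line p : seq nat := [seq (p i).+1 | i <- enum 'I_n].

Definition contains p (v : seq nat) : bool :=
  [exists m : n.-tuple bool, order_iso (mask m (one_line p)) v].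

Definition involutions_avoiding (v : seq nat) : {set 'S_n} :=
  [set p : 'S_n | [forall i, p (p i) == i] & ~~ contains p v].

(* Factors running past the end of the word are shorter than v, hence are not
   counted when v is nonempty. *)
Definition occ (v : seq nat) p : nat :=
  count (fun i => order_iso (take (size v) (drop i (one_line p))) v) (iota 0 n).

Definition fixpoints p : nat := #|[set i | p i == i]|.

End Permutations.

Local Open Scope ring_scope.

(* Q[z][t]. *)
Notation Qtz := {poly {poly rat}}.
Definition Qt : Qtz := 'X.
Definition Qz : Qtz := 'X%:P.

Definition F132 : fps Qtz :=
  Fps (fun n => \sum_(p in involutions_avoiding n [:: 3; 4; 1; 2]%N)
                  Qt ^+ occ [:: 1; 3; 2]%N p * Qz ^+ fixpoints p).

(* Main.v *)
(* An involution avoids 3412 exactly when its 2-cycles, drawn as arcs, do not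
   cross.  A nonempty such involution starts either with a fixed point or with
   an arc (1 k), which splits the rest into the part under the arc and the part
   after it.  A consecutive 132 is created at the junction exactly when the part
   that follows starts with a descent, that is, with an arc.  Counting with G
   the words whose initial arc gets an extra factor t, this reads
     F = 1 + xz G + x^2 F G,   G = 1 + xz G + t x^2 F G,
   and eliminating G gives F (b - t x^2 F) = 1 with b = 1 - xz + x^2 (t - 1), so
   that b - 2 t x^2 F is the square root in the formula. *)

Require Import Defs.
From mathcomp Require Import all_boot all_order all_algebra.
From mathcomp Require Import all_fingroup zify ring.

Import GRing.Theory.

Set Implicit Arguments.
Unset Strict Implicit.
Unset Printing Implicit Defensive.

Local Open Scope nat_scope.

(** * Noncrossing involutions and the pattern 3412 *)

Definition noncrossing_inv n (f : nat -> nat) :=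
  forall i, i < n ->
    [/\ f i < n, f (f i) = i & forall j, i < j < f i -> f j < f i].

(* Words list the values of an involution of {0, ..., n - 1}, so they are shifted
   by one with respect to [one_line]. *)
Definition nc_word n (w : seq nat) :=
  size w = n /\ noncrossing_inv n (nth 0 w).

(** The definition bounds [f j] only from above. If [f j < i], then [i] lies under the arc from
    [f j] to [j], which forces [f i < j]; if [f j = i], then [f i = j]. *)
Lemma noncrossing_above n f i j :
  noncrossing_inv n f -> i < n -> i < j < f i -> i < f j.
Proof.
move=> ncf lin /andP[lij ljf]; have [lfi ffi _] := ncf i lin.
have ljn : j < n by lia.
have [lfj ffj _] := ncf j ljn; have [_ _ H] := ncf _ lfj.
case: (ltngtP i (f j)) => // [lji|eij]; last by move: ffj; rewrite -eij; lia.
by have := H i; rewrite ffj; lia.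
Qed.

(** Since [f i < f j], the position [j] is not under the arc of [i], so [f l < f i <= j < k < l]:
    the position [k] is under the arc from [f l] to [l], against [f k < f l]. *)
Lemma noncrossing_no3412 n f i j k l :
  noncrossing_inv n f -> i < j -> j < k -> k < l -> l < n ->
  f k < f l -> f l < f i -> f i < f j -> False.
Proof.
move=> ncf lij ljk lkl lln lkl' lli' lij'.
have lin : i < n by lia.
have [_ _ Hi] := ncf i lin; have [lfl ffl _] := ncf l lln.
have lfij : f i <= j by rewrite leqNgt; apply/negP => ?; have := Hi j; lia.
have := @noncrossing_above n f (f l) k ncf lfl; rewrite ffl; lia.
Qed.

(** * Decomposition of noncrossing words at the first letter *)

Definition fixw (w : seq nat) : seq nat := 0 :: map S w.
Definition arcw (u v : seq nat) : seq nat :=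
  (size u).+1 :: map S u ++ 0 :: map (addn (size u).+2) v.

Lemma nth_fixw w i :
  i < (size w).+1 -> nth 0 (fixw w) i = if i is j.+1 then (nth 0 w j).+1 else 0.
Proof. by case: i => //= i lt; rewrite (nth_map 0). Qed.

Lemma size_arcw u v : size (arcw u v) = (size u + size v).+2.
Proof. by rewrite /arcw /= size_cat /= !size_map addnS. Qed.

Lemma nth_arcw u v i : i < (size u + size v).+2 ->
  nth 0 (arcw u v) i =
    if i == 0 then (size u).+1
    else if i <= size u then (nth 0 u i.-1).+1
    else if i == (size u).+1 then 0
    else (size u).+2 + nth 0 v (i - (size u).+2).
Proof.
case: i => //= i lt; rewrite /arcw /= nth_cat size_map; case: ltnP => hi.
  by rewrite (nth_map 0).
rewrite eqSS; case: eqP => [->|ne]; first by rewrite subnn.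
have -> : i - size u = (i.+1 - (size u).+2).+1 by lia.
by rewrite /= (nth_map 0) //; lia.
Qed.

Lemma nc_word_fixw n w : nc_word n w -> nc_word n.+1 (fixw w).
Proof.
case=> sw ncw; split; first by rewrite /= size_map sw.
case=> [|i] lin; first by split=> //= j; lia.
have [H1 H2 H3] := ncw i lin.
rewrite (nth_fixw (i := i.+1)) ?sw //; split=> //.
  by rewrite nth_fixw ?sw // H2.
case=> [|j] // hj; rewrite nth_fixw ?sw; last by lia.
by have := H3 j; lia.
Qed.

Lemma nc_word_arcw a b u v :
  nc_word a u -> nc_word b v -> nc_word (a + b).+2 (arcw u v).
Proof.
case=> su ncu [sv ncv]; split; first by rewrite size_arcw su sv.
have nE := @nth_arcw u v; rewrite su sv in nE.
have E0 : nth 0 (arcw u v) 0 = a.+1 by rewrite -su.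
have E1 j : 0 < j <= a -> nth 0 (arcw u v) j = (nth 0 u j.-1).+1.
  by move=> hj; rewrite nE; [rewrite ifF ?ifT //; lia|lia].
have E2 : nth 0 (arcw u v) a.+1 = 0.
  by rewrite nE; [rewrite /= ltnn eqxx|lia].
have E3 j : a.+1 < j < (a + b).+2 ->
    nth 0 (arcw u v) j = a.+2 + nth 0 v (j - a.+2).
  by move=> hj; rewrite nE ?ifF //; lia.
move=> i lin; have [->|i_gt0] := posnP i.
  rewrite E0 E2; split=> // [|j hj]; first by lia.
  rewrite E1; last by lia.
  by have /ncu[] : j.-1 < a by lia.
have [le_ia|lt_ai] := leqP i a.
  have /ncu[H1 H2 H3] : i.-1 < a by lia.
  rewrite (E1 i) ?i_gt0 //; split; first by lia.
    by rewrite E1 /= ?H2; lia.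
  move=> j hj; rewrite E1; last by lia.
  by have := H3 j.-1; lia.
have [->|ia] := eqVneq i a.+1.
  by rewrite E2 E0; split; lia.
have /ncv[H1 H2 H3] : i - a.+2 < b by lia.
rewrite (E3 i); last by lia.
split; first by lia.
  rewrite E3; last by lia.
  have -> : a.+2 + nth 0 v (i - a.+2) - a.+2 = nth 0 v (i - a.+2) by lia.
  by rewrite H2; lia.
move=> j hj; rewrite E3; last by lia.
have := H3 (j - a.+2); lia.
Qed.

(** The image of 0 decides the case. The bound [size u < n] excludes [n = 0], where [n.-1] is
    truncated. *)
Lemma nc_wordS n w : nc_word n.+1 w ->
  (exists2 v, nc_word n v & w = fixw v) \/
  (exists u v, [/\ size u + size v = n.-1, size u < n, nc_word (size u) u,
     nc_word (size v) v & w = arcw u v]).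
Proof.
case=> sw ncw; set f := nth 0 w in ncw *.
have [f0n ff0 H0] := ncw 0 isT.
have [f00|f0_gt0] := posnP (f 0).
  left; have fpos i : 0 < i < n.+1 -> 0 < f i.
    move=> hi; have [|_ ffi _] := ncw i; first by lia.
    by rewrite lt0n; apply/negP => /eqP fi0; move: ffi; rewrite fi0 f00; lia.
  pose v := mkseq (fun i => (f i.+1).-1) n.
  have sv : size v = n by rewrite size_mkseq.
  have nv i : i < n -> nth 0 v i = (f i.+1).-1 by move=> h; rewrite nth_mkseq.
  exists v; first split=> // i lin.
    have [|h1 h2 h3] := ncw i.+1; first by lia.
    have p := fpos i.+1; rewrite nv //; split; first by lia.
      by rewrite nv ?prednK ?h2; lia.
    move=> j hj; rewrite nv; last by lia.
    have := h3 j.+1; have := fpos j.+1; lia.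
  apply: (@eq_from_nth _ 0) => [|i]; first by rewrite /= size_map sv.
  rewrite sw => lin; rewrite nth_fixw ?sv //; case: i lin => [|i] lin //.
  by rewrite nv // prednK // fpos.
right; set a := (f 0).-1.
have f0E : f 0 = a.+1 by rewrite /a prednK.
have in_arc i : 0 < i < a.+1 -> 0 < f i < a.+1.
  move=> hi; have := H0 i; have := @noncrossing_above _ _ 0 i ncw isT; lia.
(* The positions from 0 to [a.+1] are mapped among themselves, hence so are the later ones, [f]
   being an involution; this makes the subtraction in [v] exact. *)
have out_arc i : a.+1 < i < n.+1 -> a.+1 < f i.
  move=> hi; have [|h1 h2 _] := ncw i; first by lia.
  have := in_arc (f i); rewrite h2.
  case: (posnP (f i)) => [e|p]; first by move: h2; rewrite e; lia.
  case: (ltngtP (f i) a.+1) => // [|e]; first by lia.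
  by move: h2; rewrite e -f0E ff0; lia.
pose u := mkseq (fun i => (f i.+1).-1) a.
pose v := mkseq (fun i => f (a.+2 + i) - a.+2) (n.-1 - a).
have su : size u = a by rewrite size_mkseq.
have sv : size v = n.-1 - a by rewrite size_mkseq.
have nu i : i < a -> nth 0 u i = (f i.+1).-1 by move=> h; rewrite nth_mkseq.
have nv i : i < n.-1 - a -> nth 0 v i = f (a.+2 + i) - a.+2.
  by move=> h; rewrite nth_mkseq.
exists u, v; rewrite su sv; split; try lia.
- split=> // i lin; have := in_arc i.+1; have [|h1 h2 h3] := ncw i.+1; first by lia.
  move=> p; rewrite nu //; split; first by lia.
    by rewrite nu ?prednK ?h2; lia.
  move=> j hj; rewrite nu; last by lia.
  have := h3 j.+1; have := in_arc j.+1; lia.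
- split=> // i lin; have := out_arc (a.+2 + i).
  have [|h1 h2 h3] := ncw (a.+2 + i); first by lia.
  move=> p; rewrite nv //; split; first by lia.
    by rewrite nv ?subnKC ?h2; lia.
  move=> j hj; rewrite nv; last by lia.
  have := h3 (a.+2 + j); have := out_arc (a.+2 + j); lia.
- apply: (@eq_from_nth _ 0) => [|i]; first by rewrite size_arcw su sv; lia.
  rewrite sw -/f => lin; rewrite nth_arcw ?su ?sv; last by lia.
  case: eqP => [->//|i0]; case: leqP => ia.
    by rewrite nu; have := in_arc i.-1.+1; rewrite prednK; lia.
  case: eqP => [->|ia']; first by rewrite -f0E ff0.
  rewrite nv; last by lia.
  by have := out_arc i; rewrite [a.+2 + (i - _)]subnKC; lia.
Qed.

(** * Enumeration of the noncrossing words without repetition *)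

Lemma fixw_inj : injective fixw.
Proof. by move=> u v [] /inj_map; apply=> ? ? []. Qed.

(** The first letter gives the size of [u], so both concatenations split at the same place. *)
Lemma arcw_inj u v u' v' : arcw u v = arcw u' v' -> u = u' /\ v = v'.
Proof.
case=> su /eqP; rewrite eqseq_cat ?size_map // => /andP[/eqP eu /eqP[]].
rewrite su => ev; split; first by apply: inj_map eu => ? ? [].
exact: inj_map (@addnI _) _ _ ev.
Qed.

(* [k] is fuel: [gen k n] lists the words [w] with [nc_word n w] only when
   [n <= k]. *)
Fixpoint gen k n : seq (seq nat) :=
  if n is m.+1 then
    if k is k'.+1 then
      map fixw (gen k' m) ++
      [seq arcw uv.1 uv.2 | a <- iota 0 m,
         uv <- [seq (u, v) | u <- gen k' a, v <- gen k' (m.-1 - a)]]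
    else [::]
  else [:: [::]].

(** Closure under [fixw] and [arcw] gives soundness, [nc_wordS] completeness. *)
Lemma mem_gen k n w : n <= k -> reflect (nc_word n w) (w \in gen k n).
Proof.
move=> lnk; apply: (iffP idP).
  elim: k n lnk w => [|k IH] [|n] //= lnk w.
  - by rewrite inE => /eqP->.
  - by rewrite inE => /eqP->.
  rewrite mem_cat => /orP[/mapP[v /IH hv ->]|].
    exact/nc_word_fixw/hv.
  case/allpairsPdep=> a [_ [ha /allpairsP[[u v] /= [hu hv ->]] ->]] /=.
  rewrite mem_iota in ha.
  have -> : n.+1 = (a + (n.-1 - a)).+2 by lia.
  by apply: nc_word_arcw; apply: IH => //; lia.
elim: k n lnk w => [|k IH] [|n] //= lnk w.
- by case=> /size0nil-> _.
- by case=> /size0nil-> _.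
rewrite mem_cat => /nc_wordS[[v hv ->]|[u [v [suv su hu hv ->]]]].
  by apply/orP; left; apply/map_f/IH.
apply/orP; right; apply/allpairsPdep; exists (size u), (u, v); split=> //.
  by rewrite mem_iota; lia.
apply/allpairsP; exists (u, v); split=> //=; apply: IH => //; first by lia.
  by lia.
by have -> : n.-1 - size u = size v by lia.
Qed.

(** The first letter is 0 for [fixw] and positive for [arcw]; [arcw_inj] recovers [u] and [v], and
    [a] is the size of [u]. *)
Lemma gen_uniq k n : n <= k -> uniq (gen k n).
Proof.
elim: k n => [|k IH] [|n] //= lnk; rewrite cat_uniq; apply/and3P; split.
- by rewrite map_inj_uniq ?IH //; apply: fixw_inj.
- by apply/hasPn => _ /allpairsPdep[a [uv [_ _ ->]]]; apply/mapP => -[].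
apply: allpairs_uniq_dep.
- exact: iota_uniq.
- move=> a; rewrite mem_iota => ha; apply: allpairs_uniq; try (apply: IH; lia).
  by move=> [] ? ? [].
- move=> _ _ /allpairsPdep[a [uv [ha huv ->]]] /allpairsPdep[b [uv' [hb huv' ->]]] /=.
  rewrite !mem_iota in ha hb.
  case/allpairsP: huv huv' => -[u v] /= [hu _ ->] /allpairsP[[u' v'] /= [hu' _ ->]] /=.
  case/arcw_inj=> eu ev; subst u' v'; congr existT.
  have lak : a <= k by lia.
  have lbk : b <= k by lia.
  by case/(mem_gen _ lak): hu => <- _; case/(mem_gen _ lbk): hu' => <- _.
Qed.

(** Recursive calls of [gen] may carry spare fuel; this brings them back to a list depending on [n]
    alone. *)
Lemma perm_gen k n : n <= k -> perm_eq (gen k n) (gen n n).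
Proof.
move=> lnk; apply: uniq_perm; rewrite ?gen_uniq // => w.
by apply/mem_gen/mem_gen.
Qed.

(** * The statistics under the decomposition *)

Definition begins132 (w : seq nat) : bool :=
  if w is [:: a, b, c & _] then a < c < b else false.

Fixpoint occ132 (w : seq nat) : nat :=
  if w is _ :: s then begins132 w + occ132 s else 0.

Definition begins_descent (w : seq nat) : bool :=
  if w is [:: a, b & _] then b < a else false.

Fixpoint fixed_from k (w : seq nat) : nat :=
  if w is a :: s then (a == k) + fixed_from k.+1 s else 0.

Lemma begins132_addn m w : begins132 (map (addn m) w) = begins132 w.
Proof. by case: w => [|a [|b [|c w]]] //=; rewrite !ltn_add2l. Qed.

Lemma occ132_addn m w : occ132 (map (addn m) w) = occ132 w.
Proof.
elim: w => // a w /= ->; congr (nat_of_bool _ + _).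
exact: (begins132_addn m (a :: w)).
Qed.

(** A largest first letter cannot play the 1 of a 132. *)
Lemma occ132_max c u : all (fun i => i < c) u -> occ132 (c :: u) = occ132 u.
Proof. by case: u => [|a [|b u]] //= /and3P[_ h _]; rewrite ltnNge ltnW. Qed.

(** A factor that starts in [u] and reaches the 0 does not have its least letter first, so it is not
    a 132. *)
Lemma occ132_cat0 u v : all (leq 1) u -> occ132 (u ++ 0 :: v) = occ132 u + occ132 (0 :: v).
Proof.
elim: u => // a u IH /andP[a0 /IH{}IH].
have -> : occ132 ((a :: u) ++ 0 :: v) =
    begins132 (a :: u ++ 0 :: v) + occ132 (u ++ 0 :: v) by [].
rewrite IH [in RHS]/= -!addnA; congr (_ + _).
by case: u {IH} => [|b [|c u]] //=; case: v => [|d v] //=; rewrite ?ltn0 ?andbF.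
Qed.

(** The leading 0 plays the 1, so the next two letters only have to descend. *)
Lemma occ132_0cons v : all (leq 1) v -> occ132 (0 :: v) = begins_descent v + occ132 v.
Proof. by case: v => [|a [|b v]] //= /and3P[_ -> _]. Qed.

Lemma begins_descent_addn m w :
  begins_descent (map (addn m) w) = begins_descent w.
Proof. by case: w => [|a [|b w]] //=; rewrite ltn_add2l. Qed.

Lemma all_pos_map m (w : seq nat) : all (leq 1) (map (addn m.+1) w).
Proof. by rewrite all_map; apply/allP. Qed.

Lemma occ132_fixw w : occ132 (fixw w) = begins_descent w + occ132 w.
Proof.
by rewrite occ132_0cons ?(all_pos_map 0) // (begins_descent_addn 1) (occ132_addn 1).
Qed.

(** The opening letter exceeds all letters under the arc and the closing 0 is below all others, so a
    new 132 can start only at the closing letter. *)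
Lemma occ132_arcw u v : nc_word (size u) u ->
  occ132 (arcw u v) = occ132 u + (begins_descent v + occ132 v).
Proof.
case=> _ ncu; rewrite /arcw -cat_cons occ132_cat0 /=; last exact: (all_pos_map 0).
rewrite -/(occ132 ((size u).+1 :: map S u)) occ132_max.
  rewrite (occ132_addn 1); congr (_ + _).
  rewrite -/(occ132 (0 :: map (addn (size u).+2) v)) occ132_0cons ?all_pos_map //.
  by rewrite begins_descent_addn occ132_addn.
by apply/(all_nthP 0) => i; rewrite size_map => hi; rewrite (nth_map 0) //; case: (ncu i hi).
Qed.

Lemma begins_descent_fixw w : begins_descent (fixw w) = false.
Proof. by case: w. Qed.

Lemma begins_descent_arcw u v : nc_word (size u) u -> begins_descent (arcw u v).
Proof. by case: u => [|a u] //= [_ /(_ 0 isT)[]]. Qed.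

Lemma fixed_from_addn m k w : fixed_from (m + k) (map (addn m) w) = fixed_from k w.
Proof. by elim: w k => //= a w IH k; rewrite eqn_add2l -addnS IH. Qed.

Lemma fixed_from_cat k u v :
  fixed_from k (u ++ v) = fixed_from k u + fixed_from (k + size u) v.
Proof.
by elim: u k => [|a u IH] k //=; rewrite ?addn0 // IH addnA addSnnS.
Qed.

Lemma fixed_fixw w : fixed_from 0 (fixw w) = (fixed_from 0 w).+1.
Proof. by rewrite /= (fixed_from_addn 1 0). Qed.

Lemma fixed_arcw u v :
  fixed_from 0 (arcw u v) = fixed_from 0 u + fixed_from 0 v.
Proof.
rewrite /arcw /= fixed_from_cat (fixed_from_addn 1 0) size_map /=; congr (_ + _).
by rewrite add1n -{1}(addn0 (size u).+2) fixed_from_addn.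
Qed.

(** * Permutations avoiding 3412 as noncrossing words *)

Section Words.
Variable n : nat.
Implicit Type p : 'S_n.

Definition word p : seq nat := [seq val (p i) | i <- enum 'I_n].

Lemma size_word p : size (word p) = n.
Proof. by rewrite size_map size_enum_ord. Qed.

Lemma nth_word p (i : 'I_n) : nth 0 (word p) i = p i.
Proof. by rewrite (nth_map i) ?size_enum_ord // nth_ord_enum. Qed.

Lemma word_inj : injective word.
Proof.
by move=> p q e; apply/permP => i; apply: ord_inj; rewrite -!nth_word e.
Qed.

Lemma one_lineE p : one_line p = map S (word p).
Proof. by rewrite -map_comp. Qed.

Lemma order_iso132 u :
  order_iso u [:: 1; 3; 2] = (size u == 3) && begins132 u.
Proof.
rewrite /order_iso; case: u => [|a [|b [|c [|d u]]]] //=.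
apply/forallP/idP => [H|/andP[lac lcb] i].
  (* The pattern has 1, 2, 3 at positions 0, 2, 1, so these comparisons yield [a < c < b]. *)
  have /forallP h0 := H (inord 0); have /forallP h2 := H (inord 2).
  move: (h0 (inord 2)) (h2 (inord 1)); rewrite !inordK //=.
  by move=> /eqP-> /eqP->.
apply/forallP => j.
by case: i => -[|[|[|i]]] //= _; case: j => -[|[|[|j]]] //= _; apply/eqP; lia.
Qed.

Lemma occE p : occ [:: 1; 3; 2] p = occ132 (word p).
Proof.
rewrite -(occ132_addn 1) -[map _ _]one_lineE /occ.
have : size (one_line p) = n by rewrite size_map size_enum_ord.
move: (one_line p) => w <-; elim: w => //= a w IH; rewrite order_iso132; congr (_ + _).
  by case: w {IH} => [|b [|c w]] //=; rewrite take0.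
by rewrite -IH -[1]/(1 + 0) iotaDl count_map; apply: eq_count => i /=.
Qed.

Lemma fixpointsE p : fixpoints p = fixed_from 0 (word p).
Proof.
rewrite /fixpoints cardsE cardE size_filter -enumT /word.
(* Generalized for the induction to any list of ordinals with consecutive values from [k]. *)
have -> k (s : seq 'I_n) : map val s = iota k (size s) ->
    fixed_from k [seq val (p i) | i <- s] = count (fun i => p i == i) s.
  by elim: s k => //= i s IH k [<- /IH ->].
by apply: eq_count => i; rewrite !inE.
by rewrite val_enum_ord size_enum_ord.
Qed.

Lemma contains3412P p : reflect
  (exists i j k l : 'I_n, [/\ i < j, j < k, k < l & [/\ p k < p l, p l < p i & p i < p j]])
  (contains p [:: 3; 4; 1; 2]).
Proof.
apply: (iffP existsP) => [[m]|[i [j [k [l [lij ljk lkl [h1 h2 h3]]]]]]].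
  rewrite /one_line -map_mask.
  have : sorted ltn (map val (mask m (enum 'I_n))).
    apply: (subseq_sorted ltn_trans (s2 := iota 0 n)) (iota_ltn_sorted _ _).
    by rewrite -val_enum_ord map_subseq // mask_subseq.
  case: (mask m _) => [|i [|j [|k [|l [|? ?]]]]] //=; rewrite /order_iso //=.
  case/and4P=> lij ljk lkl _ /forallP H.
  exists i, j, k, l; split=> //.
  (* The chain 1 < 2 < 3 < 4 of the pattern sits at positions 2, 3, 0, 1. *)
  have /forallP h2 := H (inord 2); have /forallP h3 := H (inord 3).
  have /forallP h0 := H (inord 0).
  move: (h2 (inord 3)) (h3 (inord 0)) (h0 (inord 1)); rewrite !inordK //=.
  by rewrite !ltnS => /eqP-> /eqP-> /eqP->.
pose s := [:: i; j; k; l].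
(* The mask will be the indicator of [s]. Filtering by it gives back [s], as both lists increase and
   have the same elements. *)
have sE : [seq x <- enum 'I_n | x \in s] = s.
  apply: (inj_map val_inj); apply: (irr_sorted_eq ltn_trans ltnn).
  - apply: (subseq_sorted ltn_trans (s2 := iota 0 n)) (iota_ltn_sorted _ _).
    by rewrite -val_enum_ord map_subseq // filter_subseq.
  - by rewrite /= lij ljk lkl.
  by move=> x; apply: eq_mem_map => {}x; rewrite mem_filter mem_enum andbT.
have sz : size [seq x \in s | x <- enum 'I_n] == n by rewrite size_map size_enum_ord.
exists (Tuple sz); rewrite /one_line -map_mask /= -filter_mask sE.
rewrite /order_iso /=; apply/forallP => x; apply/forallP => y.
case: x => -[|[|[|[|x]]]] //= _; case: y => -[|[|[|[|y]]]] //= _;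
  by apply/eqP; lia.
Qed.

Lemma nc_wordP p : reflect (nc_word n (word p))
  (p \in involutions_avoiding n [:: 3; 4; 1; 2]).
Proof.
rewrite inE; apply: (iffP andP) => [[/forallP pp /contains3412P nc]|[_ ncp]].
  split; first exact: size_word.
  move=> i lin; have -> : i = Ordinal lin by [].
  set x := Ordinal lin; rewrite nth_word; split=> //.
    by rewrite nth_word (eqP (pp x)).
  move=> j /andP[lxj ljp]; have ljn := ltn_trans ljp (ltn_ord _).
  have -> : j = Ordinal ljn by [].
  rewrite nth_word; set y := Ordinal ljn; rewrite ltnNge; apply/negP => le.
  (* The positions [x < y < p x < p y] carry the values [p x], [p y], [x], [y], an occurrence of
     3412. *)
  apply: nc; exists x, y, (p x), (p y).
  rewrite !(eqP (pp _)); have ne : p x != p y :> nat.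
    by rewrite val_eqE (inj_eq perm_inj) -val_eqE neq_ltn lxj.
  split=> //; first by lia.
  by split=> //; lia.
split.
  apply/forallP => i; have [_ + _] := ncp i (ltn_ord i).
  by rewrite !nth_word => /val_inj->.
apply/contains3412P => -[i [j [k [l [lij ljk lkl [h1 h2 h3]]]]]].
by apply: (noncrossing_no3412 ncp lij ljk lkl (ltn_ord l)); rewrite !nth_word.
Qed.

Lemma nc_word_perm w : nc_word n w -> exists p, w = word p.
Proof.
(* The default of [insubd] is never taken, all values being below [n]. *)
case=> sw ncw; pose f (i : 'I_n) := insubd i (nth 0 w i).
have fE i : f i = nth 0 w i :> nat.
  by rewrite val_insubd; case: (ncw i (ltn_ord i)) => ->.
have f_inj : injective f.
  apply: (can_inj (g := f)) => i; apply: val_inj; rewrite /= !fE.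
  by case: (ncw i (ltn_ord i)).
exists (perm f_inj); apply: (@eq_from_nth _ 0); first by rewrite size_word.
by move=> i; rewrite sw => lin; rewrite -[i]/(nat_of_ord (Ordinal lin)) nth_word permE fE.
Qed.

Lemma perm_gen_words :
  perm_eq (gen n n) [seq word p | p <- enum (involutions_avoiding n [:: 3; 4; 1; 2])].
Proof.
apply: uniq_perm; first exact: gen_uniq.
  by rewrite map_inj_uniq ?enum_uniq //; apply: word_inj.
move=> w; apply/mem_gen/mapP => // [ncw|[p]].
  have [p wE] := nc_word_perm ncw; exists p => //.
  by rewrite mem_enum; apply/nc_wordP; rewrite -wE.
by rewrite mem_enum => /nc_wordP ? ->.
Qed.

End Words.

Local Open Scope ring_scope.

(** * Recurrences for the coefficients *)

Definition weight (w : seq nat) : Qtz := Qt ^+ occ132 w * Qz ^+ fixed_from 0 w.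

(* The generating function of the words that may follow a smaller letter: an
   initial descent then completes a 132. *)
Definition G132 : fps Qtz :=
  Fps (fun n => \sum_(w <- gen n n) Qt ^+ begins_descent w * weight w).

Lemma F132_gen k n : (n <= k)%N -> F132 n = \sum_(w <- gen k n) weight w.
Proof.
move=> lnk; rewrite (perm_big _ (perm_gen lnk)) (perm_big _ (perm_gen_words n)) /=.
rewrite big_map big_enum /=; apply: eq_bigr => p _.
by rewrite /weight occE fixpointsE.
Qed.

Lemma G132_gen k n : (n <= k)%N ->
  G132 n = \sum_(w <- gen k n) Qt ^+ begins_descent w * weight w.
Proof. by move=> lnk; rewrite (perm_big _ (perm_gen lnk)). Qed.

(** In both shapes the last part follows a smaller letter and is counted by [G132], while the part
    under an arc is counted by [F132]. The factors [c] and [d] alone distinguish the recurrences of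
    the two series. *)
Lemma sum_genS (f : seq nat -> Qtz) (c d : Qtz) n :
  (forall w, f (fixw w) = c * (Qt ^+ begins_descent w * weight w)) ->
  (forall u v, nc_word (size u) u ->
     f (arcw u v) = d * (weight u * (Qt ^+ begins_descent v * weight v))) ->
  \sum_(w <- gen n.+1 n.+1) f w =
    c * G132 n + d * \sum_(a < n) F132 a * G132 (n.-1 - a)%N.
Proof.
move=> ff fa; rewrite [gen _ _]/= big_cat big_map big_allpairs_dep [G132 n]/= mulr_sumr.
congr (_ + _); first by apply: eq_bigr => w _; rewrite ff.
rewrite -[n in iota 0 n]subn0 -/(index_iota 0 n) big_mkord mulr_sumr.
apply: eq_bigr => a _.
have lan : (a <= n)%N by apply: ltnW.
have lbn : (n.-1 - a <= n)%N by lia.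
rewrite big_allpairs (F132_gen lan) (G132_gen lbn) big_distrlr mulr_sumr /=.
(* Membership of [u] in the list is kept, since [fa] asks for a noncrossing word. *)
rewrite big_seq [RHS]big_seq; apply: eq_bigr => u hu.
rewrite mulr_sumr; apply: eq_bigr => v _; apply: fa.
by have [su ncu] := mem_gen _ lan hu; rewrite su.
Qed.

Lemma F132_0 : F132 0%N = 1.
Proof. by rewrite (F132_gen (leqnn 0)) big_seq1 /weight !expr0 mulr1. Qed.

Lemma G132_0 : G132 0%N = 1.
Proof. by rewrite (G132_gen (leqnn 0)) big_seq1 /weight !expr0 !mulr1. Qed.

Lemma F132_S n :
  F132 n.+1 = Qz * G132 n + \sum_(a < n) F132 a * G132 (n.-1 - a)%N.
Proof.
rewrite (F132_gen (leqnn n.+1)) (@sum_genS _ Qz 1) ?mul1r // => [w|u v ncu].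
  by rewrite /weight occ132_fixw fixed_fixw exprD exprS; ring.
by rewrite /weight occ132_arcw // fixed_arcw !exprD; ring.
Qed.

(** An initial arc makes a descent and brings the extra [Qt]; an initial fixed point does not. *)
Lemma G132_S n :
  G132 n.+1 = Qz * G132 n + Qt * \sum_(a < n) F132 a * G132 (n.-1 - a)%N.
Proof.
rewrite (G132_gen (leqnn n.+1)) (@sum_genS _ Qz Qt) // => [w|u v ncu].
  rewrite /weight begins_descent_fixw occ132_fixw fixed_fixw.
  by rewrite expr0 exprD exprS; ring.
rewrite /weight begins_descent_arcw // occ132_arcw // fixed_arcw.
by rewrite expr1 !exprD; ring.
Qed.

(** * Functional equations of the two series *)

Section FpsCoefficients.
Variables (R : comNzRingType) (f g : fps R).

Lemma fcoefD n : (f + g) n = f n + g n. Proof. by []. Qed.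

Lemma fcoefCM c n : (fpsC c * f) n = c * f n.
Proof.
rewrite fcoefM big_ord_recl /= subn0 big1 ?addr0 // => i _.
by rewrite mul0r.
Qed.

Lemma fcoefXM n : (fpsX R * f) n = if n is m.+1 then f m else 0.
Proof.
rewrite fcoefM big_ord_recl /= mul0r add0r; case: n => [|n]; first by rewrite big_ord0.
rewrite big_ord_recl /= mul1r subSS subn0 big1 ?addr0 // => i _.
by rewrite mul0r.
Qed.

End FpsCoefficients.

Lemma fcoefX_mul (R : comNzRingType) (f g : fps R) n :
  (fpsX R * (f * g)) n = \sum_(a < n) f a * g (n.-1 - a)%N.
Proof. by rewrite fcoefXM; case: n => [|n]; rewrite ?big_ord0. Qed.

Lemma F132_eq :
  F132 = 1 + fpsX Qtz * (fpsC Qz * G132 + fpsX Qtz * (F132 * G132)).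
Proof.
apply/fpsP => -[|n]; rewrite fcoefD fcoefXM fcoef1; first by rewrite F132_0 addr0.
by rewrite fcoefD fcoefCM fcoefX_mul F132_S add0r.
Qed.

Lemma G132_eq :
  G132 = 1 + fpsX Qtz * (fpsC Qz * G132 + fpsC Qt * (fpsX Qtz * (F132 * G132))).
Proof.
apply/fpsP => -[|n]; rewrite fcoefD fcoefXM fcoef1; first by rewrite G132_0 addr0.
by rewrite fcoefD !fcoefCM fcoefX_mul G132_S add0r.
Qed.

(** * Elimination and the square root *)

Lemma system_quadratic (R : comNzRingType) (x t z f g : R) :
  f = 1 + x * (z * g + x * (f * g)) ->
  g = 1 + x * (z * g + t * (x * (f * g))) ->
  f * ((1 - x * z + x ^+ 2 * t - x ^+ 2) - t * x ^+ 2 * f) = 1.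
Proof.
move=> ef eg.
have e0 : f - 1 - x * (z * g + x * (f * g)) = 0 by rewrite -addrA -opprD -ef subrr.
have e1 : g - 1 - x * (z * g + t * (x * (f * g))) = 0.
  by rewrite -addrA -opprD -eg subrr.
apply/eqP; rewrite -subr_eq0; apply/eqP.
(* The relations read [f - 1 - d * g = 0] and [(c - d) * g - 1 = 0]; the multipliers [c - d] and [d]
   cancel [g]. *)
pose c := 1 - (t - 1) * x ^+ 2 * f; pose d := x * z + x ^+ 2 * f.
transitivity ((f - 1 - x * (z * g + x * (f * g))) * (c - d) +
  (g - 1 - x * (z * g + t * (x * (f * g)))) * d).
  by rewrite /c /d; ring.
by rewrite e0 e1 !mul0r addr0.
Qed.

Theorem theorem4p3 :
  let x : fps Qtz := fpsX Qtz in
  let t : fps Qtz := fpsC Qt in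
  let z : fps Qtz := fpsC Qz in
  F132 =
    2 / (1 - x * z + x ^+ 2 * t - x ^+ 2
         + fps_sqrt ((1 - x * z - x ^+ 2 * (t - 1)) ^+ 2
                     - 4 * x * (x + x ^+ 2 * z * (t - 1)))).
Proof.
move=> x t z; have quad := system_quadratic F132_eq G132_eq.
rewrite -/x -/t -/z in quad; set b := (_ - x ^+ 2) in quad *.
have U2 : 2%:R \is a @GRing.unit Qtz.
  apply/unitrPr; exists (2^-1)%:P%:P.
  by rewrite -!polyC_natr -!polyCM divff.
(* Completing the square in [quad] gives [s ^+ 2 = b ^+ 2 - 4 * (t * x ^+ 2)], which expands to the
   stated radicand. *)
set s := b - 2 * (t * x ^+ 2 * F132).
have <- : s = fps_sqrt ((1 - x * z - x ^+ 2 * (t - 1)) ^+ 2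
                     - 4 * x * (x + x ^+ 2 * z * (t - 1))).
  apply: fps_sqrt_unique => //.
    transitivity (b ^+ 2 - 4 * (t * x ^+ 2) * (F132 * (b - t * x ^+ 2 * F132))).
      by rewrite /s; ring.
    by rewrite quad /b; ring.
  (* The constant term 1 selects the branch of the root. *)
  have -> : s = 1 + x * (- z + x * t - x - 2 * (t * x * F132)) by rewrite /s /b; ring.
  by rewrite fcoefD fcoefXM fcoef1 addr0.
(* The denominator is twice the inverse of [F132] exhibited by [quad]. *)
have -> : b + s = 2 * (b - t * x ^+ 2 * F132) by rewrite /s; ring.
(* A series is a unit when its constant term is; here that term is 2, so [U2] applies by
   conversion. *)
have U2' : (2 : fps Qtz) \is a GRing.unit by exact: U2.
have Ui : b - t * x ^+ 2 * F132 \is a GRing.unit.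
  by apply/unitrPr; exists F132; rewrite mulrC.
by rewrite invrM // mulrCA divrr // mulr1; apply: (mulIr Ui); rewrite quad mulVr.
Qed.
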